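(* Let $G=(S,A,\downarrow,\to)$ be a labeled transition system and $B\subseteq A$. Let $\preceq_B$ be the partial bisimilarity preorder on $S$ and $\simeq_B=\preceq_B\cap\preceq_B^{-1}$. Let $\mathcal P=S/\!\simeq_B$ and define $\sqsubseteq$ on $\mathcal P$ by $[p]_{\simeq_B}\sqsubseteq[q]_{\simeq_B}$ if and only if $p\preceq_B q$. Then $(\mathcal P,\sqsubseteq)$ is the $\lhd$-maximal partition-relation pair over $G$ that is stable with respect to $\downarrow$, $\to$ and $B$.
   Context: A labeled transition system $G=(S,A,\downarrow,\to)$ has state set $S$, action set $A$, termination predicate $\downarrow\subseteq S$ (write $p\downarrow$) and transition relation $\to\subseteq S\times A\times S$ (write $p\xrightarrow{a}q$). A relation $R\subseteq S\times S$ is a partial bisimulation w.r.t. $B$ if for all $(p,q)\in R$: (1) $p\downarrow$ implies $q\downarrow$; (2) if $p\xrightarrow{a}p'$ with $a\in A$ then $q\xrightarrow{a}q'$ for some $q'$ with $(p',q')\in R$; (3) if $q\xrightarrow{b}q'$ with $b\in B$ then $p\xrightarrow{b}p'$ for some $p'$ with $(p',q')\in R$. Partial bisimilarity: $p\preceq_B q$ iff $(p,q)\in R$ for some partial bisimulation $R$ w.r.t. $B$ (this is a preorder). A partition-relation pair is $(\mathcal P,\sqsubseteq)$ with $\mathcal P$ a partition of $S$ and $\sqsubseteq\subseteq\mathcal P\times\mathcal P$ a partial order. $(\mathcal P,\sqsubseteq)\lhd(\mathcal P',\sqsubseteq')$ iff for all $P,Q\in\mathcal P$ with $P\sqsubseteq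 Q$ there exist $P',Q'\in\mathcal P'$ with $P\subseteq P'$, $Q\subseteq Q'$, $P'\sqsubseteq'Q'$. For a class $P$ write $P\downarrow$ if all its states terminate, $P\not\downarrow$ if none does. For $P,X\subseteq S$: $P\xrightarrow{a}_\exists X$ means some $p\in P$ has $p\xrightarrow{a}x$ with $x\in X$; $P\xrightarrow{a}_\forall X$ means every $p\in P$ has some $x\in X$ with $p\xrightarrow{a}x$. $\mathrm{lb}(P)=\bigcup\{Q\in\mathcal P\mid Q\sqsubseteq P\}$, $\mathrm{bb}(P)=\bigcup\{Q\in\mathcal P\mid P\sqsubseteq Q\}$. $(\mathcal P,\sqsubseteq)$ is stable if: (a) every class $P$ has $P\downarrow$ or $P\not\downarrow$; (b) $P\sqsubseteq Q$ and $P\downarrow$ imply $Q\downarrow$; (c) for $P,Q,R\in\mathcal P$, $a\in A$: $P\sqsubseteq Q$ and $P\xrightarrow{a}_\exists R$ imply $Q\xrightarrow{a}_\forall\mathrm{bb}(R)$; (d) for $P,Q,R\in\mathcal P$, $b\in B$: $P\sqsubseteq Q$ and $Q\xrightarrow{b}_\exists R$ imply $P\xrightarrow{b}_\forall\mathrm{lb}(R)$. *)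

(* Defs.v *)
From mathcomp Require Import all_boot.
From mathcomp Require Export boolp classical_sets.

Set Implicit Arguments.
Unset Strict Implicit.
Unset Printing Implicit Defensive.

Local Open Scope classical_set_scope.

(* States and actions are arbitrary types: neither finiteness nor image
   finiteness is required. *)
Record lts := Lts {
  state : Type;
  action : Type;
  terminating : set state;
  trans : state -> action -> state -> Prop }.

Section PartialBisimilarity.
Variables (G : lts) (B : set (action G)).
Local Notation S := (state G).

Definition partial_bisimulation (R : S -> S -> Prop) : Prop :=
  forall p q, R p q ->
  [/\ terminating p -> terminating q,
      forall a p', trans p a p' -> exists2 q', trans q a q' & R p' q'
    & forall b q', B b -> trans q b q' -> exists2 p', trans p b p' & R p' q'].

Definition pbisimilar (p q : S) : Prop :=
  exists2 R, partial_bisimulation R & R p q.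

Definition mutual_pbisimilar (p q : S) : Prop :=
  pbisimilar p q /\ pbisimilar q p.

Definition pbclass (p : S) : set S := [set q | mutual_pbisimilar p q].

End PartialBisimilarity.

(* A candidate partition together with a relation on blocks; the conditions
   making it a partition-relation pair are in [is_prpair], so that equality of
   pairs is equality of these two components. *)
Record prpair (S : Type) := PRPair {
  blocks : set (set S);
  ble : set S -> set S -> Prop }.

(* The first clause on [ble] says that it is a relation on the partition, that
   is, it relates blocks only. *)
Definition is_prpair (S : Type) (X : prpair S) : Prop :=
  partition (blocks X) id [set: S] /\
  [/\ forall P Q, ble X P Q -> blocks X P /\ blocks X Q,
      forall P, blocks X P -> ble X P P,
      forall P Q, ble X P Q -> ble X Q P -> P = Q
    & forall P Q R, ble X P Q -> ble X Q R -> ble X P R].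

Definition finer (S : Type) (X Y : prpair S) : Prop :=
  forall P Q, blocks X P -> blocks X Q -> ble X P Q ->
  exists P' Q', [/\ blocks Y P' /\ blocks Y Q',
                    P `<=` P', Q `<=` Q' & ble Y P' Q'].

Definition lb (S : Type) (X : prpair S) (P : set S) : set S :=
  \bigcup_(Q in [set Q | blocks X Q /\ ble X Q P]) Q.

Definition bb (S : Type) (X : prpair S) (P : set S) : set S :=
  \bigcup_(Q in [set Q | blocks X Q /\ ble X P Q]) Q.

Section Stability.
Variables (G : lts) (B : set (action G)).
Local Notation S := (state G).

Definition trans_ex (P : set S) (a : action G) (X : set S) : Prop :=
  exists2 p, P p & exists2 x, X x & trans p a x.

Definition trans_all (P : set S) (a : action G) (X : set S) : Prop :=
  forall p, P p -> exists2 x, X x & trans p a x.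

Definition all_term (P : set S) : Prop := forall p, P p -> terminating p.

Definition none_term (P : set S) : Prop := forall p, P p -> ~ terminating p.

Definition stable (X : prpair S) : Prop :=
  [/\ forall P, blocks X P -> all_term P \/ none_term P,
      forall P Q, blocks X P -> blocks X Q ->
        ble X P Q -> all_term P -> all_term Q,
      forall P Q R a, blocks X P -> blocks X Q -> blocks X R ->
        ble X P Q -> trans_ex P a R -> trans_all Q a (bb X R)
    & forall P Q R b, blocks X P -> blocks X Q -> blocks X R -> B b ->
        ble X P Q -> trans_ex Q b R -> trans_all P b (lb X R)].

Definition stable_prpair (X : prpair S) : Prop := is_prpair X /\ stable X.

Definition maximal_stable_prpair (X : prpair S) : Prop :=
  stable_prpair X /\ forall Y, stable_prpair Y -> finer X Y -> Y = X.

(* [ble] is given through representatives; [ble_pbisim_prpair] below shows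
   that it does not depend on their choice. *)
Definition pbisim_prpair : prpair S := {|
  blocks := range (pbclass B);
  ble := fun P Q => exists p q,
    [/\ P = pbclass B p, Q = pbclass B q & pbisimilar B p q] |}.

Lemma pbisimilar_refl p : pbisimilar B p p.
Proof.
exists eq => // {}p _ <-; split=> // [a p' pp'|b p' _ pp']; by exists p'.
Qed.

Lemma pbisimilar_trans q p r :
  pbisimilar B p q -> pbisimilar B q r -> pbisimilar B p r.
Proof.
move=> [R1 bR1 pq] [R2 bR2 qr].
exists (fun x z => exists2 y, R1 x y & R2 y z); last by exists q.
move=> x z [y xy yz].
have [t1 f1 g1] := bR1 _ _ xy; have [t2 f2 g2] := bR2 _ _ yz.
split=> [/t1/t2//|a x' /f1[y' /f2[z' zz' yz'] xy']|b z' Bb].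
  by exists z' => //; exists y'.
move=> /(g2 _ _ Bb)[y' /(g1 _ _ Bb)[x' xx' xy'] yz'].
by exists x' => //; exists y'.
Qed.

Lemma ble_pbisim_prpair p q :
  ble pbisim_prpair (pbclass B p) (pbclass B q) <-> pbisimilar B p q.
Proof.
split=> [[p' [q' [pp' qq' p'q']]]|pq]; last by exists p, q.
have : pbclass B p p by split; apply: pbisimilar_refl.
have : pbclass B q q by split; apply: pbisimilar_refl.
rewrite {1}qq' {1}pp' => -[q'q _] [_ pp0].
exact: pbisimilar_trans pp0 (pbisimilar_trans p'q' q'q).
Qed.

End Stability.

(* Main.v *)
From mathcomp Require Import all_boot.
Require Import Defs.

(** Membership in [⊑]-related classes of a stable pair is a partial bisimulation,
    so every stable pair is finer than the pair induced by partial bisimilarity,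
    which is itself stable. On partition-relation pairs [finer] is antisymmetric,
    so the greatest stable pair is also the only maximal one. *)

Set Implicit Arguments.
Unset Strict Implicit.
Unset Printing Implicit Defensive.

Local Open Scope classical_set_scope.

Section PartitionRelationPairs.
Variable S : Type.
Implicit Types X Y : prpair S.

Lemma block_cover X x : is_prpair X -> exists2 P, blocks X P & P x.
Proof.
case=> -[cover _ _] _; have : [set: S] x by [].
by rewrite -cover => -[P XP Px]; exists P.
Qed.

Lemma block_nonempty X P : is_prpair X -> blocks X P -> P !=set0.
Proof. by case=> -[_ _ X0] _ /X0. Qed.

Lemma block_eq X P Q x :
  is_prpair X -> blocks X P -> blocks X Q -> P x -> Q x -> P = Q.
Proof. by case=> -[_ tX _] _ XP XQ Px Qx; apply: tX => //; exists x. Qed.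

Lemma block_sub_eq X P Q :
  is_prpair X -> blocks X P -> blocks X Q -> P `<=` Q -> P = Q.
Proof.
move=> prX XP XQ PQ; have [x Px] := block_nonempty prX XP.
exact: block_eq prX XP XQ Px (PQ x Px).
Qed.

(** Reflexivity of [ble] turns [finer] into inclusions of single blocks. Going to [Y] and back
    encloses a block [P] as [P] ⊆ [P'] ⊆ [P'']. Blocks of [X] that are nested coincide, so [P'] is
    squeezed onto [P]. *)
Lemma finer_sub_blocks X Y :
  is_prpair X -> finer X Y -> finer Y X -> blocks X `<=` blocks Y.
Proof.
move=> prX XY YX P XP.
have [_ [_ reflX _ _]] := prX.
have [P' [Q' [[YP' YQ'] PP' PQ' P'Q']]] := XY P P XP XP (reflX P XP).
have [P'' [_ [[XP'' _] P'P'' _ _]]] := YX P' Q' YP' YQ' P'Q'.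
have PP'' : P = P''.
  by apply: block_sub_eq prX XP XP'' _; apply: subset_trans P'P''.
suff -> : P = P' by [].
by rewrite eqEsubset; split=> //; rewrite [X in _ `<=` X]PP''.
Qed.

(** Since [ble X] relates blocks only, [finer] applies to [P] and [Q]. Both are already blocks of
    [Y], so the blocks of [Y] enclosing them are [P] and [Q] themselves. *)
Lemma finer_sub_ble X Y P Q :
  is_prpair X -> is_prpair Y -> finer X Y -> finer Y X ->
  ble X P Q -> ble Y P Q.
Proof.
move=> prX prY XY YX PQ.
have [_ [relX _ _ _]] := prX; have [XP XQ] := relX _ _ PQ.
have [P' [Q' [[YP' YQ'] PP' QQ' P'Q']]] := XY P Q XP XQ PQ.
have sub := finer_sub_blocks prX XY YX.
rewrite (block_sub_eq prY (sub _ XP) YP' PP').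
by rewrite (block_sub_eq prY (sub _ XQ) YQ' QQ').
Qed.

Lemma finer_antisym X Y :
  is_prpair X -> is_prpair Y -> finer X Y -> finer Y X -> X = Y.
Proof.
move=> prX prY XY YX.
have eq_blocks : blocks X = blocks Y.
  by rewrite eqEsubset; split; apply: finer_sub_blocks.
have eq_ble : ble X = ble Y.
  by apply/funext => P; apply/funext => Q; apply/propext; split;
    apply: finer_sub_ble.
by case: X Y eq_blocks eq_ble {prX prY XY YX} => [? ?] [? ?] /= -> ->.
Qed.

End PartitionRelationPairs.

Section PartialBisimilarityPair.
Variables (G : lts) (B : set (action G)).
Implicit Types (p q r : state G) (Y : prpair (state G)).
Local Notation pb := (pbisimilar B).
Local Notation cls := (pbclass B).
Local Notation PB := (pbisim_prpair B).

(** Partial bisimilarity is itself a partial bisimulation: the relation witnessing [pb p q] also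
    witnesses the pairs of successors. *)
Lemma pbisimilarP p q : pb p q ->
  [/\ terminating p -> terminating q,
      forall a p', trans p a p' -> exists2 q', trans q a q' & pb p' q'
    & forall b q', B b -> trans q b q' -> exists2 p', trans p b p' & pb p' q'].
Proof.
move=> [R bR pq]; have [t f g] := bR _ _ pq; split=> //.
  by move=> a p' /f[q' qq' R']; exists q' => //; exists R.
by move=> b q' Bb /(g _ _ Bb)[p' pp' R']; exists p' => //; exists R.
Qed.

Lemma pbclass_refl p : cls p p.
Proof. by split; apply: pbisimilar_refl. Qed.

Lemma pbclass_eq p q : mutual_pbisimilar B p q -> cls p = cls q.
Proof.
move=> [pq qp]; apply/funext => r; apply/propext; split=> -[h1 h2];
  by split; apply: pbisimilar_trans; eassumption.
Qed.

Lemma pbisim_is_prpair : is_prpair PB.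
Proof.
split; split.
- by rewrite eqEsubset; split=> // p _; exists (cls p);
    [exists p | apply: pbclass_refl].
- move=> _ _ [p _ <-] [q _ <-] [r [/pbclass_eq + /pbclass_eq]].
  by move=> /= -> ->.
- by move=> _ [p _ <-]; exists p; apply: pbclass_refl.
- by move=> P Q [p [q [-> -> _]]]; split; [exists p | exists q].
- by move=> _ [p _ <-]; exists p, p; split=> //; apply: pbisimilar_refl.
- move=> P Q [p [q [-> -> pq]]] /ble_pbisim_prpair qp.
  exact: pbclass_eq.
- move=> P Q R [p [q [-> -> pq]]] [q' [r [qq' -> q'r]]].
  exists p, r; split=> //; apply: pbisimilar_trans pq _.
  by apply/ble_pbisim_prpair; rewrite qq'; apply/ble_pbisim_prpair.
Qed.

(** The chain [p'], [p], [q], [q'] is increasing. This is how a move of one state of a class comes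
    to be matched by every state of a related class. *)
Lemma pbclass_pbisimilar p q p' q' :
  pb p q -> cls p p' -> cls q q' -> pb p' q'.
Proof.
move=> pq [_ p'p] [qq' _].
exact: pbisimilar_trans p'p (pbisimilar_trans pq qq').
Qed.

Lemma pbisim_stable : stable B PB.
Proof.
split.
- move=> _ [p _ <-]; have [tp|ntp] := pselect (terminating p).
    (* Termination passes up from [p] to [q]; in the other branch, termination of [q] would pass
       back to [p]. *)
    by left=> q [/pbisimilarP[+ _ _] _]; apply.
  by right=> q [_ /pbisimilarP[+ _ _]] tq => /(_ tq).
- move=> P Q _ _ [p [q [-> -> pq]]] tp r qr.
  have [+ _ _] := pbisimilarP (pbclass_pbisimilar pq (pbclass_refl p) qr).
  by apply; apply: tp; apply: pbclass_refl.
- move=> P Q _ a _ _ [r _ <-] [p [q [-> -> pq]]] [p1 pp1 [r1 rr1 tr1]] q1 qq1.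
  have [_ + _] := pbisimilarP (pbclass_pbisimilar pq pp1 qq1).
  move=> /(_ _ _ tr1)[q' q1q' r1q']; exists q' => //.
  (* The class of the matching successor lies above that of [r], as [r] is below [r1] and [r1] below
     [q']. *)
  exists (cls q'); last exact: pbclass_refl.
  split; first by exists q'.
  by apply/ble_pbisim_prpair; case: rr1 => rr1 _; apply: pbisimilar_trans r1q'.
- move=> P Q _ b _ _ [r _ <-] Bb [p [q [-> -> pq]]] [q1 qq1 [r1 rr1 tr1]] p1 pp1.
  have [_ _] := pbisimilarP (pbclass_pbisimilar pq pp1 qq1).
  move=> /(_ _ _ Bb tr1)[p' p1p' p'r1]; exists p' => //.
  (* Dually, [p'] is below [r1] and [r1] below [r]. *)
  exists (cls p'); last exact: pbclass_refl.
  split; first by exists p'.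
  by apply/ble_pbisim_prpair; case: rr1 => _; apply: pbisimilar_trans p'r1.
Qed.

Definition block_rel Y p q : Prop :=
  exists P Q, [/\ P p, Q q & ble Y P Q].

(** Stability is applied to the block [R] of the given successor; unfolding [bb] or [lb] then yields
    a block related to [R] that holds the matching successor. *)
Lemma block_rel_partial_bisimulation Y :
  stable_prpair B Y -> partial_bisimulation B (block_rel Y).
Proof.
move=> [prY [term mono fwd bwd]] p q [P [Q [Pp Qq PQ]]].
have [_ [relY _ _ _]] := prY; have [YP YQ] := relY _ _ PQ.
split.
- move=> tp; have [tP|/(_ _ Pp)//] := term _ YP.
  exact: mono PQ tP q Qq.
- move=> a p' pp'; have [R YR Rp'] := block_cover p' prY.
  have PR : trans_ex P a R by exists p => //; exists p'.
  have [q' [R' [YR' RR'] R'q'] qq'] := fwd _ _ _ _ YP YQ YR PQ PR q Qq.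
  by exists q' => //; exists R, R'.
- move=> b q' Bb qq'; have [R YR Rq'] := block_cover q' prY.
  have QR : trans_ex Q b R by exists q => //; exists q'.
  have [p' [R' [YR' R'R] R'p'] pp'] := bwd _ _ _ _ YP YQ YR Bb PQ QR p Pp.
  by exists p' => //; exists R', R.
Qed.

Lemma stable_finer_pbisim Y : stable_prpair B Y -> finer Y PB.
Proof.
move=> sY; have [prY _] := sY; have [_ [_ reflY _ _]] := prY.
have pbY P Q p q : ble Y P Q -> P p -> Q q -> pb p q.
  move=> PQ Pp Qq; exists (block_rel Y); last by exists P, Q.
  exact: block_rel_partial_bisimulation.
(* Reflexivity of [ble] relates two states of one block in both directions. *)
have subcls P p : blocks Y P -> P p -> P `<=` cls p.
  by move=> /reflY PP Pp p' Pp'; split; apply: pbY PP _ _.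
move=> P Q YP YQ PQ.
have [p Pp] := block_nonempty prY YP; have [q Qq] := block_nonempty prY YQ.
exists (cls p), (cls q); split; [|exact: subcls|exact: subcls|].
  by split; [exists p | exists q].
by apply/ble_pbisim_prpair; apply: pbY PQ _ _.
Qed.

End PartialBisimilarityPair.

Theorem theorem6 (G : lts) (B : set (action G)) :
  unique (maximal_stable_prpair B) (pbisim_prpair B) /\
  (forall Y : prpair (state G),
     stable_prpair B Y -> finer Y (pbisim_prpair B)).
Proof.
have sPB : stable_prpair B (pbisim_prpair B).
  by split; [apply: pbisim_is_prpair | apply: pbisim_stable].
split; last exact: stable_finer_pbisim.
(* A maximal [Z] is finer than the stable pair of bisimilarity, hence equal to it. *)
split; last by move=> Z [sZ maxZ]; apply: maxZ sPB (stable_finer_pbisim sZ).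
split=> // Y sY PBY.
by apply: finer_antisym PBY; [case: sY | case: sPB | exact: stable_finer_pbisim].
Qed.
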